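(* Let $X$ be a nonnegative random variable with probability density function $g$, let $k\in\mathbb{N}$, let $w(\lambda,x)$ be a weight function that is $\mathrm{TP}_k$, and let $f:\mathbb{R}_+\to\mathbb{R}_+$ be a non-decreasing function. Let $\lambda_1>\cdots>\lambda_k>0$. Then all minors (of every order) of the $k\times k$ matrix whose $(i,j)$ entry is $$H\big[\lambda_i,(f(X))^{k-j}\big],\qquad i,j=1,\ldots,k,$$ are nonnegative. Further, if $w(\lambda,x)$ is $\mathrm{STP}_k$ and the set of points of increase of $f$ contains an open set, then all minors of this matrix are positive.
   Context: A weight function is a function $w(\lambda,x)$ of a loading parameter $\lambda>0$ and $x\in\mathbb{R}_+=[0,\infty)$, Borel-measurable in $x$ for each $\lambda$. It is $\mathrm{TP}_k$ (totally positive of order $k$) if for every $r=1,\ldots,k$, all $\lambda_1>\cdots>\lambda_r$ and all $x_1>\cdots>x_r$, the $r\times r$ determinant $\det(w(\lambda_i,x_j))$ is $\ge 0$; it is $\mathrm{STP}_k$ (strictly totally positive of order $k$) if all these determinants are $>0$. In particular a $\mathrm{TP}_k$ weight function is nonnegative. For $h:\mathbb{R}_+\to\mathbb{R}_+$, the generalized weighted premium is $H[\lambda,h(X)]=\mathbb{E}[w(\lambda,X)h(X)]/\mathbb{E}[w(\lambda,X)]$. It is assumed throughout that all expectations involved converge absolutely and that $\mathbb{E}[w(\lambda,X)]>0$, so that these quantities are defined. The zeroth power is read as $(f(X))^0=1$, so $H[\lambda,(f(X))^0]=1$. A point of increase of $f$ is a point in every neighbourhood of which $f$ is non-constant; the hypothesis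 that the set of such points contains an open set is meant as: $f$ is strictly increasing on some nonempty open set.
   Formalization: In the ''Further'' part, the open set on which f is strictly increasing is also required to have positive probability under X; without this the claim fails, e.g. if X is uniform on [0,1] and f(x)=max(x-2,0). *)

(* Defs.v *)
From HB Require Import structures.
From mathcomp Require Import all_boot all_order all_algebra.
From mathcomp Require Import all_classical all_reals all_analysis.
From mathcomp Require Import measurable_realfun.

Set Implicit Arguments.
Unset Strict Implicit.
Unset Printing Implicit Defensive.

Import Order.TTheory GRing.Theory Num.Theory.
Import numFieldNormedType.Exports.

Local Open Scope classical_set_scope.
Local Open Scope ring_scope.

(* Functions on R_+ = [0, +oo[ (and weights on ]0, +oo[ x [0, +oo[) are encoded
   as total functions on R; every condition below is restricted to that domain,
   so the values outside it are irrelevant. *)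

Definition decreasing_family (R : realType) (r : nat) (x : 'I_r -> R) : Prop :=
  forall i j : 'I_r, (i < j)%N -> x j < x i.

Definition weight_function (R : realType) (w : R -> R -> R) : Prop :=
  forall l : R, 0 < l -> measurable_fun (`[0, +oo[ : set R) (w l).

Definition TP (R : realType) (k : nat) (w : R -> R -> R) : Prop :=
  forall r : nat, (1 <= r <= k)%N ->
  forall l x : 'I_r -> R,
    decreasing_family l -> (forall i, 0 < l i) ->
    decreasing_family x -> (forall j, 0 <= x j) ->
    0 <= \det (\matrix_(i < r, j < r) w (l i) (x j)).

Definition STP (R : realType) (k : nat) (w : R -> R -> R) : Prop :=
  forall r : nat, (1 <= r <= k)%N ->
  forall l x : 'I_r -> R,
    decreasing_family l -> (forall i, 0 < l i) ->
    decreasing_family x -> (forall j, 0 <= x j) ->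
    0 < \det (\matrix_(i < r, j < r) w (l i) (x j)).

Definition has_density d (T : measurableType d) (R : realType)
    (P : probability T R) (X : {RV P >-> R}) (g : R -> R) : Prop :=
  [/\ measurable_fun setT g, forall x, 0 <= g x &
      forall A : set R, measurable A ->
        distribution P X A = (\int[lebesgue_measure]_(x in A) (g x)%:E)%E].

(* The expectations are extended reals; [fine] returns their real value, and is
   meaningful only when both of them are finite. *)
Definition weighted_premium d (T : measurableType d) (R : realType)
    (P : probability T R) (X : {RV P >-> R}) (w : R -> R -> R)
    (l : R) (h : R -> R) : R :=
  fine 'E_P[fun t => w l (X t) * h (X t)] / fine 'E_P[fun t => w l (X t)].

(* Indices start at 0, so column j (the (j+1)-st) carries the exponent
   k - (j + 1). *)
Definition premium_matrix d (T : measurableType d) (R : realType)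
    (P : probability T R) (X : {RV P >-> R}) (w : R -> R -> R) (f : R -> R)
    (k : nat) (l : 'I_k -> R) : 'M[R]_k :=
  \matrix_(i < k, j < k)
    weighted_premium X w (l i) (fun x => f x ^+ (k - j.+1)).

(* A minor of order r selects rows and columns by increasing maps into 'I_k. *)
Definition minors_ge0 (R : realType) (k : nat) (A : 'M[R]_k) : Prop :=
  forall (r : nat) (rho sigma : 'I_r -> 'I_k),
    {homo rho : i j / (i < j)%N} -> {homo sigma : i j / (i < j)%N} ->
    0 <= \det (mxsub rho sigma A).

Definition minors_gt0 (R : realType) (k : nat) (A : 'M[R]_k) : Prop :=
  forall (r : nat) (rho sigma : 'I_r -> 'I_k),
    {homo rho : i j / (i < j)%N} -> {homo sigma : i j / (i < j)%N} ->
    0 < \det (mxsub rho sigma A).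

(* f is strictly increasing on the nonempty, relatively open subset
   U `&` [0, +oo[ of the half-line. *)
Definition increasing_on_open (R : realType) (f : R -> R) (U : set R) : Prop :=
  [/\ open U, U `&` `[0, +oo[ !=set0 &
      forall x y : R, U x -> U y -> 0 <= x -> x < y -> f x < f y].

(* Main.v *)
(* Writing a_i(x) = w(l_i, x) and b_j(x) = f(x)^(k-j), a minor of the premium
   matrix is a positive multiple of det (E[a_i(X) b_j(X)]), and by Andreief's
   identity r! det (E[a_i(X) b_j(X)]) is the integral over the r-tuples
   (x_1, ..., x_r) of det (a_i(x_p)) det (b_j(x_p)).  Sorting the x_p changes
   both determinants by the same sign; then the first is >= 0 by total
   positivity, and the second is a generalized Vandermonde determinant in
   f(x_1) >= ... >= f(x_r) >= 0, which is >= 0 by repeated use of the mean value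
   theorem.  Since the integrand is a sum of products of functions of one
   variable, the variables are integrated out one at a time, without any product
   measure.  In the strict case the integrand is > 0 at the tuples of distinct
   points of U where f > 0; as X has no atoms, excluding finitely many values and
   the at most one zero of f in U removes only null sets. *)

Require Import Defs.
From HB Require Import structures.
From mathcomp Require Import all_boot all_order all_algebra.
From mathcomp Require Import perm polyrcf.
From mathcomp Require Import all_classical all_reals all_analysis.
From mathcomp Require Import measurable_realfun.

Set Implicit Arguments.
Unset Strict Implicit.
Unset Printing Implicit Defensive.

Import Order.TTheory GRing.Theory Num.Theory.
Import numFieldNormedType.Exports.

Local Open Scope classical_set_scope.
Local Open Scope ring_scope.

(** * Sorting and generalized Vandermonde determinants *)

Lemma sort_decreasing_family (R : realType) (r : nat) (x : 'I_r -> R) :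
  injective x -> exists s : 'S_r, decreasing_family (x \o s).
Proof.
move=> inj_x; pose t := [tuple - x i | i < r].
have /tuple_permP[s def_s] : perm_eq (sort <=%O t) t by rewrite perm_sort.
exists s => i j lt_ij /=.
have srt : sorted <%O (sort <=%O t).
  by rewrite sort_lt_sorted map_inj_uniq ?enum_uniq// => p q /oppr_inj/inj_x.
have nthE (p : 'I_r) : - x (s p) = nth 0 (sort <=%O t) p.
  by rewrite def_s -tnth_nth !tnth_mktuple.
have sz : size (sort <=%O t) = r by rewrite size_sort size_tuple.
by rewrite -ltrN2 !nthE lt_sorted_ltn_nth ?inE ?sz.
Qed.

(* The mean value theorem is applied to one row at a time: the determinant is
   linear in that row, with the cofactors as coefficients. *)
Lemma det_mvt_gt0 (R : rcfType) (n : nat) (G : 'I_n -> {poly R})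
    (a b : 'I_n -> R) :
  (forall p, a p < b p) ->
  (forall s : 'I_n -> R, (forall p, a p < s p < b p) ->
     0 < \det (\matrix_(p, j) (G j)^`().[s p])) ->
  0 < \det (\matrix_(p, j) ((G j).[b p] - (G j).[a p])).
Proof.
move=> lt_ab pos.
(* The first [m] rows hold increments, the others derivatives at the points [s]; the induction turns
   one row at a time into increments. *)
pose M m (s : 'I_n -> R) : 'M[R]_n :=
  \matrix_(p, j) (if (p < m)%N then (G j).[b p] - (G j).[a p]
                  else (G j)^`().[s p]).
suff M_gt0 m : (m <= n)%N -> forall s : 'I_n -> R,
    (forall p, a p < s p < b p) -> 0 < \det (M m s).
  have := M_gt0 n (leqnn n) (fun p => (a p + b p) / 2).
  rewrite (_ : M _ _ = \matrix_(p, j) ((G j).[b p] - (G j).[a p])).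
    by apply=> p; rewrite !midf_lt.
  by apply/matrixP => p j; rewrite !mxE ltn_ord.
elim: m => [_ s s_in|m IHm lt_mn s s_in].
  rewrite (_ : M _ _ = \matrix_(p, j) (G j)^`().[s p]); first exact: pos.
  by apply/matrixP => p j; rewrite !mxE.
pose p0 := Ordinal lt_mn; set A := M _ _.
(* The cofactors ignore row [p0], so the increment of [q] is [\det A] and its derivative at [c] is
   the determinant with row [p0] differentiated at [c]. *)
pose q := \sum_j cofactor A p0 j *: G j.
have -> : \det A = q.[b p0] - q.[a p0].
  rewrite (expand_det_row _ p0) !horner_sum -sumrB; apply: eq_bigr => j _.
  by rewrite !hornerZ -mulrBr mulrC; congr (_ * _); rewrite mxE ltnSn.
have [c c_in ->] := poly_mvt q (lt_ab p0).
rewrite mulr_gt0 ?subr_gt0//.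
have := IHm (ltnW lt_mn) (dfwith s p0 c); set B := M _ _.
have -> : \det B = q^`().[c].
  rewrite (expand_det_row _ p0) linear_sum horner_sum; apply: eq_bigr => j _.
  rewrite linearZ hornerZ mulrC; congr (_ * _); last first.
    by rewrite mxE ltnn dfwithin.
  congr (_ * \det _); apply/matrixP => i l; rewrite !mxE.
  have ne_i := neq_lift p0 i.
  have ne_m : (lift p0 i == m :> nat) = false.
    by rewrite -(inj_eq val_inj) eq_sym in ne_i; apply: negPf.
  by rewrite dfwithout// ltnS [in RHS]leq_eqVlt ne_m.
by apply=> p; case: dfwithP.
Qed.

(* The last hypothesis allows the smallest node to be 0 when the smallest
   exponent is 0. *)
Lemma det_pow_gt0 (R : realType) (n : nat) (y : 'I_n.+1 -> R)
    (e : 'I_n.+1 -> nat) :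
  {homo e : i j / (i < j)%N >-> (j < i)%N} -> decreasing_family y ->
  (forall p, 0 <= y p) -> 0 < y ord_max ^+ e ord_max ->
  0 < \det (\matrix_(p, j) y p ^+ e j).
Proof.
elim: n => [|n IHn] in y e *; move=> e_decr y_decr y_ge0 y_gt0.
  by rewrite det_mx11 mxE -[X in y X ^+ e X](ord1 ord_max).
set d := e ord_max in y_gt0.
have le_max (p : 'I_n.+2) : (p <= n.+1)%N by rewrite -ltnS.
have yd_gt0 p : 0 < y p ^+ d.
  have [->//|ne_p] := eqVneq p ord_max.
  have lt_p : (p < @ord_max n.+1)%N by rewrite ltn_neqAle ne_p le_max.
  by rewrite exprn_gt0// (le_lt_trans (y_ge0 ord_max))// y_decr.
have de j : (d <= e j)%N.
  have [->//|ne_j] := eqVneq j ord_max.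
  by rewrite ltnW// e_decr// ltn_neqAle ne_j le_max.
pose N : 'M[R]_n.+2 := \matrix_(p, j) y p ^+ (e j - d).
have -> : \matrix_(p, j) y p ^+ e j = diag_mx (\row_p y p ^+ d) *m N.
  by apply/matrixP => p j; rewrite mul_diag_mx !mxE -exprD subnKC.
rewrite det_mulmx det_diag mulr_gt0 ?prodr_gt0// => [p _|].
  by rewrite mxE.
(* [L] subtracts from each row but the last the next one; the last column, which
   is constant in [N], becomes that of a unit matrix. *)
pose L : 'M[R]_n.+2 := \matrix_(p, q) ((p == q)%:R - (q == p.+1 :> nat)%:R).
have det_L : \det L = 1.
  rewrite -det_tr det_trig => [|]; last first.
    apply/is_trig_mxP => i j lt_ij; rewrite !mxE.
    by rewrite eq_sym -val_eqE /= !ltn_eqF ?subr0// ltnW.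
  by apply: big1 => i _; rewrite !mxE eqxx ltn_eqF ?subr0.
have LN_max j : (L *m N) ord_max j = N ord_max j.
  rewrite mxE (bigD1 ord_max)//= big1 ?addr0 => [|q ne_q].
    by rewrite mxE eqxx ltn_eqF ?subr0 ?mul1r.
  by rewrite mxE eq_sym (negPf ne_q) (ltn_eqF (ltn_ord q)) subr0 mul0r.
have LN_lift p j : (L *m N) (lift ord_max p) j =
    N (lift ord_max p) j - N (lift ord0 p) j.
  rewrite mxE; under eq_bigr do rewrite mxE mulrBl.
  rewrite sumrB; congr (_ - _).
    rewrite (bigD1 (lift ord_max p))//= big1 ?addr0 => [|q ne_q].
      by rewrite eqxx mul1r.
    by rewrite eq_sym (negPf ne_q) mul0r.
  have succE (q : 'I_n.+2) :
      (q == (lift ord_max p).+1 :> nat) = (q == lift ord0 p).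
    by rewrite lift_max -(lift0 p) (inj_eq val_inj).
  rewrite (bigD1 (lift ord0 p))// big1 => [|q ne_q].
    by rewrite succE eqxx mul1r /= addr0.
  by rewrite succE (negPf ne_q) mul0r.
rewrite -[\det N]mul1r -det_L -det_mulmx (expand_det_col _ ord_max).
rewrite (bigD1 ord_max)//= big1 ?addr0 => [|p]; last first.
  case: (unliftP ord_max p) => [p' ->|->]; last by rewrite eqxx.
  by rewrite LN_lift !mxE subnn !expr0 subrr mul0r.
rewrite LN_max mxE subnn expr0 mul1r /cofactor -signr_odd oddD addbb mul1r.
pose G (j : 'I_n.+1) : {poly R} := 'X^(e (lift ord_max j) - d).
rewrite (_ : row' _ _ = \matrix_(p, j)
    ((G j).[y (lift ord_max p)] - (G j).[y (lift ord0 p)])); last first.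
  by apply/matrixP => p j; rewrite [LHS]mxE [LHS]mxE LN_lift !mxE !hornerXn.
apply: det_mvt_gt0 => [p|s s_in]; first by rewrite y_decr// lift_max.
have ed_gt0 (j : 'I_n.+1) : (0 < e (lift ord_max j) - d)%N.
  by rewrite subn_gt0 e_decr// lift_max.
(* Each column of derivatives is a positive constant times a column of powers of [s], with one node
   and one exponent fewer than at the start. *)
rewrite (_ : \matrix_(p, j) _ = (\matrix_(p, j)
      s p ^+ (e (lift ord_max j) - d).-1) *m
    diag_mx (\row_j (e (lift ord_max j) - d)%:R)); last first.
  apply/matrixP => p j.
  by rewrite mul_mx_diag !mxE derivXn hornerMn hornerXn mulr_natr.
have s_gt0 p : 0 < s p.
  by case/andP: (s_in p) => + _; apply: le_lt_trans.
rewrite det_mulmx det_diag mulr_gt0 ?prodr_gt0 // => [|j _].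
- apply: IHn => [i j lt_ij|i j lt_ij|p|].
  + by rewrite -ltnS !prednK// ltn_sub2r// ?e_decr ?lift_max// -subn_gt0.
  (* The mean value points interlace the nodes: [s_j < y_j <= y_(i+1) < s_i]. *)
  + have /andP[_ sj] := s_in j; have /andP[si _] := s_in i.
    apply: lt_le_trans sj (le_trans _ (ltW si)).
    have [eq_ij|ne_ij] := eqVneq (i.+1 : nat) j.
      rewrite (_ : lift ord_max j = lift ord0 i)//.
      by apply: ord_inj; rewrite lift_max lift0.
    by apply/ltW/y_decr; rewrite lift_max lift0 ltn_neqAle ne_ij.
  + exact/ltW.
  + exact: exprn_gt0.
- by rewrite mxE ltr0n.
Qed.

(** Outside the strict case the determinant is 0: equal nodes give equal rows, and a last node 0
    with positive last exponent gives a zero row. *)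
Lemma det_pow_ge0 (R : realType) (n : nat) (y : 'I_n -> R) (e : 'I_n -> nat) :
  {homo e : i j / (i < j)%N >-> (j < i)%N} ->
  {homo y : i j / (i < j)%N >-> j <= i} ->
  (forall p, 0 <= y p) -> 0 <= \det (\matrix_(p, j) y p ^+ e j).
Proof.
case: n => [|n] in y e *; move=> e_decr y_nincr y_ge0.
  by rewrite det_mx00.
have [/injectiveP inj_y|/injectivePn[i [j ne_ij eq_y]]] := boolP (injectiveb y);
  last first.
  by rewrite (determinant_alternate ne_ij) // => l; rewrite !mxE eq_y.
have := exprn_ge0 (e ord_max) (y_ge0 ord_max).
rewrite le_eqVlt => /predU1P[yd0|yd_gt0]; last first.
  apply/ltW/det_pow_gt0 => // i j lt_ij.
  rewrite lt_neqAle y_nincr// andbT; apply: contraTneq lt_ij => /inj_y ->.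
  by rewrite ltnn.
move/esym/eqP: yd0; rewrite expf_eq0 => /andP[d_gt0 /eqP y0].
rewrite (expand_det_row _ ord_max) big1// => j _; rewrite mxE y0 expr0n.
rewrite (_ : e j == 0 = false) ?mul0r//; apply/gtn_eqF/(leq_trans d_gt0).
have [->//|ne_j] := eqVneq j ord_max.
by rewrite ltnW// e_decr// ltn_neqAle ne_j -ltnS ltn_ord.
Qed.

(** * Mixed discriminants *)

(* This is r! times the usual mixed discriminant. *)
Definition mixed_discriminant (R : comNzRingType) (r : nat)
    (M : 'I_r -> 'M[R]_r) : R :=
  \sum_(s : 'S_r) \sum_(u : 'S_r)
    (-1) ^+ s * (-1) ^+ u * \prod_p M p (s p) (u p).

(** Writing [u] as [s * v] cancels the sign of [s]; reindexing the product by [s] then leaves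
    [\det A] for each of the [r!] permutations [s]. *)
Lemma mixed_discriminant_cst (R : comNzRingType) (r : nat) (A : 'M[R]_r) :
  mixed_discriminant (fun=> A) = r`!%:R * \det A.
Proof.
rewrite -card_Sn mulr_natl -sumr_const; apply: eq_big => // s _.
rewrite (reindex_inj (mulgI s)); apply: eq_bigr => v _.
rewrite odd_permM signr_addb !mulrA -signr_addb addbb mul1r; congr (_ * _).
rewrite [RHS](reindex_inj (@perm_inj _ s)); apply: eq_bigr => p _.
by rewrite permM.
Qed.

Lemma mixed_discriminant_rank1 (R : comNzRingType) (r : nat) (A B : 'M[R]_r) :
  mixed_discriminant (fun p => \matrix_(i, j) (A p i * B p j)) =
  \det A * \det B.
Proof.
rewrite /determinant big_distrlr /=.
apply: eq_bigr => s _; apply: eq_bigr => u _.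
rewrite mulrACA -big_split /=; congr (_ * _); apply: eq_bigr => p _.
by rewrite mxE.
Qed.

(** Each term contains a single entry of the matrix at [p]. As [c] is independent of [N], the same
    coefficients serve for a matrix of functions and for the matrix of their integrals. *)
Lemma mixed_discriminant_linear (R : comNzRingType) (r : nat)
    (M : 'I_r -> 'M[R]_r) (p : 'I_r) :
  exists c : 'S_r * 'S_r -> R, forall N,
    mixed_discriminant (dfwith M p N) = \sum_q c q * N (q.1 p) (q.2 p).
Proof.
exists (fun q : 'S_r * 'S_r => (-1) ^+ q.1 * (-1) ^+ q.2 *
                 \prod_(p' | p' != p) M p' (q.1 p') (q.2 p')) => N.
rewrite /mixed_discriminant pair_bigA; apply: eq_bigr => q _.
rewrite (bigD1 p)//= dfwithin -!mulrA; congr (_ * (_ * _)).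
rewrite mulrC; congr (_ * _); apply: eq_bigr => p' ne_p'.
by rewrite dfwithout// eq_sym.
Qed.


(** * Integrals of linear combinations and of nonnegative functions *)

Lemma integrable_lincomb d (T : measurableType d) (R : realType)
    (mu : {measure set T -> \bar R}) (J : finType) (c : J -> R)
    (phi : J -> T -> R) :
  (forall j, mu.-integrable setT (EFin \o phi j)) ->
  mu.-integrable setT (EFin \o (fun t => \sum_j c j * phi j t)).
Proof.
move=> int_phi.
rewrite (_ : _ \o _ = fun t => (\sum_j (c j)%:E * (phi j t)%:E)%E).
  by apply: integrable_sum => // j _; apply: integrableZl => //; exact: int_phi.
by apply/funext => t /=; rewrite -sumEFin.
Qed.

Lemma Rintegral_lincomb d (T : measurableType d) (R : realType)
    (mu : {measure set T -> \bar R}) (J : finType) (c : J -> R)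
    (phi : J -> T -> R) :
  (forall j, mu.-integrable setT (EFin \o phi j)) ->
  \int[mu]_(t in setT) (\sum_j c j * phi j t) =
  \sum_j c j * \int[mu]_(t in setT) phi j t.
Proof.
move=> int_phi; rewrite /Rintegral.
under eq_integral do
  (rewrite -sumEFin; under eq_bigr do rewrite EFinM).
rewrite integral_sum // => [|j]; last first.
  by apply: integrableZl => //; exact: int_phi.
rewrite -sum_fine => [|j _]; last first.
  by apply/integrable_fin_num => //; apply: integrableZl => //; exact: int_phi.
by apply: eq_bigr => j _; rewrite -RintegralZl.
Qed.

Lemma Rintegral_gt0_nonnegligible d (T : measurableType d) (R : realType)
    (mu : {measure set T -> \bar R}) (phi : T -> R) :
  mu.-integrable setT (EFin \o phi) -> (forall t, 0 <= phi t) ->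
  ~ mu.-negligible [set t | 0 < phi t] -> 0 < \int[mu]_(t in setT) phi t.
Proof.
move=> int_phi phi_ge0 ndeg.
rewrite lt_neqAle Rintegral_ge0// andbT; apply/negP => /eqP int0; apply: ndeg.
have fin : (\int[mu]_(t in setT) (phi t)%:E \is a fin_num)%E.
  exact: integrable_fin_num int_phi.
have : (\int[mu]_(t in setT) `|(phi t)%:E| = 0)%E.
  under eq_integral do rewrite gee0_abs ?lee_fin//.
  by rewrite -(fineK fin) -[fine _]int0.
move/ae_eq_integral_abs => /(_ measurableT (measurable_int _ int_phi)).
apply: negligibleS => t /= phi_gt0 /(_ I) [] /eqP.
by rewrite gt_eqF.
Qed.

(** * Andreief's identity, one variable at a time *)

(* Interpolates between det (a_i(t_p)) * det (b_j(t_p)) at m = 0 and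
   r! * det (\int a_i b_j) at m = r by integrating out t_0, ..., t_(m-1). *)
Definition partial_andreief d (T : measurableType d) (R : realType)
    (mu : {measure set T -> \bar R}) (r : nat) (a b : 'I_r -> T -> R)
    (m : nat) (t : 'I_r -> T) : R :=
  mixed_discriminant (fun p : 'I_r => if (p < m)%N
    then \matrix_(i, j) \int[mu]_(x in setT) (a i x * b j x)
    else \matrix_(i, j) (a i (t p) * b j (t p))).

Section andreief.
Context d (T : measurableType d) (R : realType).
Context (mu : {measure set T -> \bar R}) (r : nat) (a b : 'I_r -> T -> R).
Context (int_ab : forall i j,
  mu.-integrable setT (EFin \o (fun x => a i x * b j x))).

Let Z := partial_andreief mu a b.

Lemma partial_andreief0 t : Z 0 t =
  \det (\matrix_(p, i) a i (t p)) * \det (\matrix_(p, j) b j (t p)).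
Proof.
rewrite -mixed_discriminant_rank1; congr mixed_discriminant; apply/funext => p.
by apply/matrixP => i j; rewrite !mxE.
Qed.

Lemma partial_andreief_full t : Z r t =
  r`!%:R * \det (\matrix_(i, j) \int[mu]_(x in setT) (a i x * b j x)).
Proof.
rewrite -mixed_discriminant_cst; congr mixed_discriminant; apply/funext => p.
by rewrite ltn_ord.
Qed.

(** In its coordinate [m], [Z m] is a finite linear combination of the products [a i x * b j x], so
    it is integrated term by term. *)
Lemma partial_andreiefS (m : 'I_r) t :
  mu.-integrable setT (EFin \o (fun x => Z m (dfwith t m x))) /\
  Z m.+1 t = \int[mu]_(x in setT) Z m (dfwith t m x).
Proof.
pose M (p : 'I_r) : 'M[R]_r := if (p < m)%N
  then \matrix_(i, j) \int[mu]_(x in setT) (a i x * b j x)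
  else \matrix_(i, j) (a i (t p) * b j (t p)).
have [c cE] := mixed_discriminant_linear M m.
have -> : (fun x => Z m (dfwith t m x)) =
    (fun x => \sum_q c q * (a (q.1 m) x * b (q.2 m) x)).
  apply/funext => x; transitivity (mixed_discriminant
      (dfwith M m (\matrix_(i, j) (a i x * b j x)))).
    congr mixed_discriminant; apply/funext => p; rewrite /M.
    case: dfwithP => [|p' ne_p']; first by rewrite ltnn dfwithin.
    by rewrite dfwithout.
  by rewrite cE; apply: eq_bigr => q _; rewrite mxE.
split; first exact: integrable_lincomb.
rewrite Rintegral_lincomb//.
transitivity (mixed_discriminant (dfwith M m
    (\matrix_(i, j) \int[mu]_(x in setT) (a i x * b j x)))).
  congr mixed_discriminant; apply/funext => p; rewrite /M.
  case: dfwithP => [|p' ne_p']; first by rewrite ltnSn.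
  rewrite ltnS leq_eqVlt (_ : (p' == m :> nat) = false)//.
  by rewrite eq_sym; apply: negPf.
by rewrite cE; apply: eq_bigr => q _; rewrite mxE.
Qed.

Context (det_ge0 : forall t : 'I_r -> T,
  0 <= \det (\matrix_(p, i) a i (t p)) * \det (\matrix_(p, j) b j (t p))).

Lemma partial_andreief_ge0 m t : (m <= r)%N -> 0 <= Z m t.
Proof.
elim: m => [|m IHm] in t *; first by rewrite partial_andreief0.
move=> lt_mr; have [_ ->] := partial_andreiefS (Ordinal lt_mr) t.
by apply: Rintegral_ge0 => x _; apply/IHm/ltnW.
Qed.

Lemma det_Rintegral_mul_ge0 (t : T) :
  0 <= \det (\matrix_(i, j) \int[mu]_(x in setT) (a i x * b j x)).
Proof.
have := partial_andreief_ge0 (fun=> t) (leqnn r).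
by rewrite partial_andreief_full pmulr_rge0// ltr0n fact_gt0.
Qed.

Lemma det_Rintegral_mul_gt0 (V : Type) (X : T -> V) (G : set T) :
  (forall v, mu.-negligible (X @^-1` [set v])) -> ~ mu.-negligible G ->
  (forall t : 'I_r -> T, injective (X \o t) -> (forall p, G (t p)) ->
     0 < \det (\matrix_(p, i) a i (t p)) * \det (\matrix_(p, j) b j (t p))) ->
  0 < \det (\matrix_(i, j) \int[mu]_(x in setT) (a i x * b j x)).
Proof.
move=> fibre0 G_big det_gt0.
(* The coordinates not yet integrated out lie in [G] and have distinct values of [X]. At [m = r]
   this is void, so a constant tuple will do. *)
suff Z_gt0 m t : (m <= r)%N -> (forall p : 'I_r, (m <= p)%N -> G (t p)) ->
    (forall p q : 'I_r, (m <= p)%N -> (m <= q)%N ->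
       X (t p) = X (t q) -> p = q) ->
    0 < Z m t.
  have [x _] : G !=set0.
    by apply/set0P/eqP => G0; apply: G_big; rewrite G0; exact: negligible_set0.
  have := Z_gt0 r (fun=> x) (leqnn r).
  rewrite partial_andreief_full pmulr_rgt0 ?ltr0n ?fact_gt0//; apply => p.
    by rewrite leqNgt ltn_ord.
  by move=> q; rewrite leqNgt ltn_ord.
elim: m => [|m IHm] in t *.
  move=> _ Gt inj_t; rewrite partial_andreief0; apply: det_gt0 => [p q|p].
    exact: inj_t.
  exact: Gt.
move=> lt_mr Gt inj_t; pose p0 := Ordinal lt_mr.
have [int_Z ->] := partial_andreiefS p0 t.
apply: Rintegral_gt0_nonnegligible => // [x|Z_small].
  exact/partial_andreief_ge0/ltnW.
(* [B] is a finite union of fibres, hence negligible; any point of [G] outside it keeps the values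
   of [X] distinct, so the integrand is positive there. *)
apply: G_big; pose B := \big[setU/set0]_(p < r) (X @^-1` [set X (t p)]).
apply: (@negligibleS _ _ _ _
    ([set x | 0 < Z p0 (dfwith t p0 x)] `|` B)); last first.
  apply: negligibleU => //; rewrite /B; elim/big_ind: _ => //.
  - exact: negligible_set0.
  - by move=> ? ?; exact: negligibleU.
move=> x Gx; have [Bx|nBx] := pselect (B x); [by right|left => /=].
have nX p : X x <> X (t p).
  move=> Xx; apply: nBx; rewrite /B -bigcup_seq; exists p => //=.
  exact: mem_index_enum.
have gt_m (p : 'I_r) : (m <= p)%N -> p0 != p -> (m < p)%N.
  by rewrite ltn_neqAle -val_eqE /= => -> ->.
apply: IHm => [|p|p q]; first exact: ltnW.
  by case: dfwithP => // p' ne_p' /gt_m/(_ ne_p'); exact: Gt.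
case: dfwithP => [|p' ne_p']; case: dfwithP => [|q' ne_q'] //.
- by move=> _ _ /nX.
- by move=> _ _ /esym/nX.
- by move=> /gt_m/(_ ne_p') ltp /gt_m/(_ ne_q') ltq; exact: inj_t.
Qed.

End andreief.

(** * Sign of the integrand *)

Lemma det_row_perm_mul (R : comNzRingType) (r : nat) (s : 'S_r)
    (A B : 'M[R]_r) :
  \det (row_perm s A) * \det (row_perm s B) = \det A * \det B.
Proof.
by rewrite !row_permE !det_mulmx !det_perm mulrACA -signr_addb addbb mul1r.
Qed.

(** If two points coincide, the first determinant is 0. Distinct points can be sorted, but may share
    a value of [f], hence the nonstrict bound for the powers. *)
Lemma TP_det_mul_pow_ge0 (R : realType) (k r : nat) (w : R -> R -> R)
    (f : R -> R) (l x : 'I_r -> R) (e : 'I_r -> nat) :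
  TP k w -> (r <= k)%N -> decreasing_family l -> (forall i, 0 < l i) ->
  (forall x, 0 <= x -> 0 <= f x) ->
  (forall x y, 0 <= x -> x <= y -> f x <= f y) ->
  {homo e : i j / (i < j)%N >-> (j < i)%N} -> (forall p, 0 <= x p) ->
  0 <= \det (\matrix_(p, i) w (l i) (x p)) *
       \det (\matrix_(p, j) f (x p) ^+ e j).
Proof.
move=> wTP le_rk l_decr l_gt0 f_ge0 f_ndecr e_decr x_ge0.
have [/injectiveP inj_x|/injectivePn[i [j ne_ij eq_x]]] := boolP (injectiveb x);
  last first.
  by rewrite (determinant_alternate ne_ij) ?mul0r// => p; rewrite !mxE eq_x.
case: (posnP r) => [r0|r_gt0]; first by subst r; rewrite !det_mx00 mulr1.
have [s xs_decr] := sort_decreasing_family inj_x.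
rewrite -(det_row_perm_mul s) mulr_ge0//.
  (* Here the points index the rows; in [TP] they index the columns. *)
  rewrite -det_tr (_ : _^T = \matrix_(i, p) w (l i) ((x \o s) p)).
    by apply: wTP => // [|p]; [rewrite r_gt0|exact: x_ge0].
  by apply/matrixP => i p; rewrite !mxE.
rewrite (_ : row_perm _ _ = \matrix_(p, j) f ((x \o s) p) ^+ e j).
  apply: det_pow_ge0 => // [p q lt_pq|p]; last exact/f_ge0/x_ge0.
  by apply: f_ndecr; [exact: x_ge0|exact/ltW/(xs_decr p q)].
by apply/matrixP => p j; rewrite !mxE.
Qed.

Lemma STP_det_mul_pow_gt0 (R : realType) (k r : nat) (w : R -> R -> R)
    (f : R -> R) (l x : 'I_r -> R) (e : 'I_r -> nat) :
  STP k w -> (r <= k)%N -> decreasing_family l -> (forall i, 0 < l i) ->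
  {homo e : i j / (i < j)%N >-> (j < i)%N} -> injective x ->
  (forall p, 0 <= x p) -> (forall p, 0 < f (x p)) ->
  (forall p q, x p < x q -> f (x p) < f (x q)) ->
  0 < \det (\matrix_(p, i) w (l i) (x p)) *
      \det (\matrix_(p, j) f (x p) ^+ e j).
Proof.
case: r => [|r] in l x e *; first by rewrite !det_mx00 mulr1.
move=> wSTP le_rk l_decr l_gt0 e_decr inj_x x_ge0 f_gt0 f_incr.
have [s xs_decr] := sort_decreasing_family inj_x.
rewrite -(det_row_perm_mul s) mulr_gt0//.
  rewrite -det_tr (_ : _^T = \matrix_(i, p) w (l i) ((x \o s) p)).
    by apply: wSTP => // p; exact: x_ge0.
  by apply/matrixP => i p; rewrite !mxE.
rewrite (_ : row_perm _ _ = \matrix_(p, j) f ((x \o s) p) ^+ e j).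
  apply: det_pow_gt0 => // [p q lt_pq|p|]; first exact/f_incr/xs_decr.
    exact/ltW/f_gt0.
  exact/exprn_gt0/f_gt0.
by apply/matrixP => p j; rewrite !mxE.
Qed.

(** * Null sets for the distribution of [X] *)

Lemma has_density_atomless d (T : measurableType d) (R : realType)
    (P : probability T R) (X : {RV P >-> R}) (g : R -> R) (v : R) :
  has_density X g -> P.-negligible (X @^-1` [set v]).
Proof.
move=> [_ _ dist]; exists (X @^-1` [set v]); split => //.
by have := dist [set v] (measurable_set1 v); rewrite integral_set1.
Qed.

(** All [t] with [U (X t)] and [f (X t) = 0] lie in one fibre of [X]. Discarding them keeps the
    smallest node of the power determinant positive. *)
Lemma increasing_on_open_nonnegligible d (T : measurableType d) (R : realType)
    (P : probability T R) (X : {RV P >-> R}) (f : R -> R) (U : set R) :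
  (forall t, 0 <= X t) -> (forall v, P.-negligible (X @^-1` [set v])) ->
  (forall x, 0 <= x -> 0 <= f x) -> increasing_on_open f U ->
  (0 < P (X @^-1` U))%E ->
  ~ P.-negligible [set t | U (X t) /\ 0 < f (X t)].
Proof.
move=> X_ge0 atomless f_ge0 [openU _ f_incr] + G_small.
have -> : P (X @^-1` U) = 0; last by rewrite ltxx.
apply/negligibleP.
  by apply: (measurable_funPTI X); exact: open_measurable.
have f0 t : U (X t) -> ~ (U (X t) /\ 0 < f (X t)) -> f (X t) = 0.
  move=> Ut nG; apply/eqP; rewrite eq_le f_ge0// andbT leNgt.
  by apply/negP => ft_gt0; exact: nG.
have [[t0 [Ut0 ft0]]|no_zero] := pselect (exists t, U (X t) /\ f (X t) = 0).
  apply: negligibleS (negligibleU G_small (atomless (X t0))) => t Ut.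
  have [Gt|/(f0 _ Ut) ft] := pselect (U (X t) /\ 0 < f (X t)); [by left|right].
  rewrite /=; case: (ltgtP (X t) (X t0)) => // lt_X.
    by have := f_incr _ _ Ut Ut0 (X_ge0 t) lt_X; rewrite ft ft0 ltxx.
  by have := f_incr _ _ Ut0 Ut (X_ge0 t0) lt_X; rewrite ft ft0 ltxx.
apply: negligibleS G_small => t Ut /=.
by apply: contrapT => /(f0 _ Ut) ft; apply: no_zero; exists t.
Qed.

(** * Minors of the premium matrix *)

(** The denominators depend only on the row, so they factor out on the left and leave a matrix of
    integrals of products. *)
Lemma mxsub_premium_matrix d (T : measurableType d) (R : realType)
    (P : probability T R) (X : {RV P >-> R}) (w : R -> R -> R) (f : R -> R)
    (k r : nat) (lam : 'I_k -> R) (rho sigma : 'I_r -> 'I_k) :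
  mxsub rho sigma (premium_matrix X w f lam) =
  diag_mx (\row_i (fine 'E_P[fun t => w (lam (rho i)) (X t)])^-1) *m
  \matrix_(i, j) \int[P]_(t in setT)
    (w (lam (rho i)) (X t) * f (X t) ^+ (k - (sigma j).+1)).
Proof.
apply/matrixP => i j; rewrite mul_diag_mx !mxE mulrC; congr (_ * _).
by rewrite unlock.
Qed.

(** The strict part asks that [X] charge [U]: if [f (X)] were almost surely constant, all rows would
    be equal and every minor of order 2 would vanish. *)
Theorem theorem3p1 (R : realType) (d : measure_display) (T : measurableType d)
    (P : probability T R) (X : {RV P >-> R}) (g : R -> R)
    (k : nat) (w : R -> R -> R) (f : R -> R) (lam : 'I_k -> R)
    (X_ge0 : forall t : T, 0 <= X t)
    (X_density : has_density X g)
    (w_weight : weight_function w)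
    (w_TP : TP k w)
    (f_ge0 : forall x : R, 0 <= x -> 0 <= f x)
    (f_ndecr : forall x y : R, 0 <= x -> x <= y -> f x <= f y)
    (lam_decr : decreasing_family lam)
    (lam_gt0 : forall i : 'I_k, 0 < lam i)
    (w_integrable : forall i : 'I_k,
      P.-integrable setT (fun t => (w (lam i) (X t))%:E))
    (wf_integrable : forall i j : 'I_k,
      P.-integrable setT (fun t => (w (lam i) (X t) * f (X t) ^+ (k - j.+1))%:E))
    (Ew_gt0 : forall i : 'I_k, (0 < 'E_P[fun t => w (lam i) (X t)])%E) :
  minors_ge0 (premium_matrix X w f lam) /\
  (STP k w ->
   (exists U : set R, increasing_on_open f U /\ (0 < P (X @^-1` U))%E) ->
   minors_gt0 (premium_matrix X w f lam)).
Proof.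
have homo_inj r (rho : 'I_r -> 'I_k) :
    {homo rho : i j / (i < j)%N} -> injective rho.
  move=> rho_homo i j eq_rho; apply: val_inj; apply/eqP.
  by case: ltngtP => // /rho_homo; rewrite eq_rho ltnn.
have le_rk r (rho : 'I_r -> 'I_k) : {homo rho : i j / (i < j)%N} -> (r <= k)%N.
  by move/homo_inj/leq_card; rewrite !card_ord.
have [t0 _] : [set: T] !=set0.
  apply/set0P/eqP => T0; have := probability_setT P.
  by rewrite T0 measure0 => /esym/eqP; rewrite onee_eq0.
(* The truncated subtraction is exact because [sigma j < k], so the exponents strictly decrease. *)
have e_decr r (sigma : 'I_r -> 'I_k) : {homo sigma : i j / (i < j)%N} ->
    {homo (fun j => k - (sigma j).+1)%N : i j / (i < j)%N >-> (j < i)%N}.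
  by move=> sigma_homo i j lt_ij; rewrite ltn_sub2lE ?ltn_ord// ltnS sigma_homo.
(* [fine] sends [+oo] to 0, so a positive expectation has a positive real value only once
   integrability makes it finite. *)
have diag_gt0 r (rho : 'I_r -> 'I_k) :
    0 < \det (diag_mx (\row_i (fine 'E_P[fun t => w (lam (rho i)) (X t)])^-1)).
  rewrite det_diag prodr_gt0// => i _; rewrite mxE invr_gt0 fine_gt0// Ew_gt0.
  by rewrite unlock ltey_eq (integrable_fin_num _ (w_integrable (rho i))).
have det_ge0 r (rho sigma : 'I_r -> 'I_k) :
    {homo rho : i j / (i < j)%N} -> {homo sigma : i j / (i < j)%N} ->
    forall t : 'I_r -> T,
    0 <= \det (\matrix_(p, i) w (lam (rho i)) (X (t p))) *
         \det (\matrix_(p, j) f (X (t p)) ^+ (k - (sigma j).+1)).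
  move=> rho_homo sigma_homo t.
  apply: (TP_det_mul_pow_ge0 (x := X \o t) w_TP (le_rk _ _ rho_homo)) => //=.
  - by move=> i j /rho_homo; exact: lam_decr.
  - exact: e_decr.
split=> [r rho sigma rho_homo sigma_homo|
  wSTP [U [fU PU_gt0]] r rho sigma rho_homo sigma_homo];
  rewrite mxsub_premium_matrix det_mulmx.
- rewrite pmulr_rge0//; apply: det_Rintegral_mul_ge0 => // [i j|].
    exact: wf_integrable.
  exact: det_ge0.
- have atomless v := has_density_atomless v X_density.
  rewrite pmulr_rgt0//; apply: (det_Rintegral_mul_gt0 _ _ atomless).
  + by move=> i j; exact: wf_integrable.
  + exact: det_ge0.
  + by apply: increasing_on_open_nonnegligible fU PU_gt0.
  + case: fU => _ _ f_incr t inj_t Gt.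
    apply: (STP_det_mul_pow_gt0 (x := X \o t) wSTP (le_rk _ _ rho_homo)) => //=.
    * by move=> i j /rho_homo; exact: lam_decr.
    * exact: e_decr.
    * by move=> p; case: (Gt p).
    * by move=> p q; apply: f_incr => //; case: (Gt p); case: (Gt q).
Qed.
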